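(* Let $q$ be a prime power, let $h\ge 1$ and $n$ be integers, and let $C$ be an $\mathbb F_q$-linear $(n,q^{3h},n-2)_{q^h}$ MDS code over $\mathbb F_{q^h}$. Suppose that one of the following holds: (1) $h=2$ and $n\ge 2q+3$; (2) $h=3$ and $n\ge q^2+3+\delta_{2,q}$, where $\delta_{2,q}=1$ if $q=2$ and $\delta_{2,q}=0$ otherwise. If $C$ has at least three coordinates such that the projection of $C$ from each of them is $\mathbb F_q$-equivalent to a linear code, then $C$ itself is $\mathbb F_q$-equivalent to a linear code.
   Context: A code of length $n$ over $\mathbb F_{q^h}$ is a subset of $\mathbb F_{q^h}^n$; an $(n,M,d)_{q^h}$ code has $M$ codewords and minimum Hamming distance $d$. It is $\mathbb F_q$-linear if it is an $\mathbb F_q$-subspace of $\mathbb F_{q^h}^n$, and linear if it is an $\mathbb F_{q^h}$-subspace. It is MDS if $M=q^{h(n-d+1)}$ (equality in the Singleton bound). Two $\mathbb F_q$-linear codes over $\mathbb F_{q^h}$ are $\mathbb F_q$-equivalent if one is obtained from the other by permuting coordinate positions and applying, in each coordinate position, an $\mathbb F_q$-linear bijection of $\mathbb F_{q^h}$ (possibly different bijections in different positions). The projection of $C$ from position $i$ is the code $\{(x_1,\dots,x_{i-1},x_{i+1},\dots,x_n) : (x_1,\dots,x_{i-1},0,x_{i+1},\dots,x_n)\in C\}$. *)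

(* Defs.v *)
From mathcomp Require Import all_boot all_order all_algebra all_fingroup all_field.
Set Implicit Arguments. Unset Strict Implicit. Unset Printing Implicit Defensive.
Import GRing.Theory.
Local Open Scope ring_scope.

Section Codes.
Variable L : finFieldType.
Variable Fq : {set L}.

Definition is_subfield : Prop :=
  [/\ 1 \in Fq,
      (forall x y, x \in Fq -> y \in Fq -> x - y \in Fq),
      (forall x y, x \in Fq -> y \in Fq -> x * y \in Fq) &
      (forall x, x \in Fq -> x^-1 \in Fq)].

Definition hdist n (u v : 'rV[L]_n) : nat := #|[set i : 'I_n | u 0 i != v 0 i]|.

Definition min_dist n (C : {set 'rV[L]_n}) (d : nat) : Prop :=
  (exists u v, [/\ u \in C, v \in C, u != v & hdist u v = d]) /\
  (forall u v, u \in C -> v \in C -> u != v -> (d <= hdist u v)%N).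

Definition code_params n (C : {set 'rV[L]_n}) (M d : nat) : Prop :=
  #|C| = M /\ min_dist C d.

Definition MDS n (C : {set 'rV[L]_n}) : Prop :=
  exists d, min_dist C d /\ #|C| = (#|L| ^ (n - d + 1))%N.

Definition Fq_linear n (C : {set 'rV[L]_n}) : Prop :=
  [/\ 0 \in C,
      (forall u v, u \in C -> v \in C -> u + v \in C) &
      (forall c u, c \in Fq -> u \in C -> c *: u \in C)].

Definition L_linear n (C : {set 'rV[L]_n}) : Prop :=
  [/\ 0 \in C,
      (forall u v, u \in C -> v \in C -> u + v \in C) &
      (forall (c : L) u, u \in C -> c *: u \in C)].

Definition Fq_linear_bij (f : L -> L) : Prop :=
  [/\ (forall x y, f (x + y) = f x + f y),
      (forall c x, c \in Fq -> f (c * x) = c * f x) &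
      bijective f].

Definition Fq_equiv n (C D : {set 'rV[L]_n}) : Prop :=
  exists (s : 'S_n) (f : 'I_n -> L -> L),
    (forall i, Fq_linear_bij (f i)) /\
    D = [set (\row_i f i (v 0 (s i))) | v : 'rV[L]_n in C].

Definition Fq_equiv_to_linear n (C : {set 'rV[L]_n}) : Prop :=
  exists D : {set 'rV[L]_n}, L_linear D /\ Fq_equiv C D.

Definition proj n (C : {set 'rV[L]_n}) (i : 'I_n) : {set 'rV[L]_n.-1} :=
  [set (\row_j v 0 (lift i j)) | v : 'rV[L]_n in C & v 0 i == 0].

End Codes.

(* Main.v *)
Require Import Defs.
From mathcomp Require Import all_boot all_order all_algebra all_fingroup all_field.
From mathcomp Require Import zify ring.
Set Implicit Arguments. Unset Strict Implicit. Unset Printing Implicit Defensive.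
Import GRing.Theory.
Local Open Scope ring_scope.

(** Any three coordinates of C determine a codeword, so C consists of the words
    (x, y, z, ..., X_j x + Y_j y + Z_j z, ...) with Fq-linear bijections X_j, Y_j, Z_j,
    where x, y, z sit at three positions whose projections are equivalent to
    linear codes. Those projections give scalars a_j, b_j, c_j of L and fixed
    Fq-linear bijections G, H, K of L with a_j G(c_j x) = H(b_j K(x)) for the
    n - 3 remaining positions j, and C is equivalent to a linear code as soon as
    one of G, H, K is semilinear over L.

    Write Fq-linear maps as linearized polynomials sum_(i < h) g_i X^(q^i). If all
    coefficients of G are nonzero, a relation sum_i e_i G(s_i x) = 0 with e_i
    independent over Fq forces s_i = 0. Picking h independent elements among the
    a_j and one more that is not proportional to any of them, an Fq-dependency
    between the h + 1 corresponding b_j then makes two of the c_j, hence two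
    of the a_j, proportional: a contradiction. The same holds with G and H
    exchanged. If h = 3 and both G and H have exactly two nonzero
    coefficients, then up to Frobenius twists both have degree q, and comparing
    coefficients of X^(q^2) shows that K is semilinear or that all the b_j are
    proportional. *)

(** * The subfield [Fq] as the fixed set of a power map *)

Section Subfield.
Variables (L : finFieldType) (Fq : {set L}).
Hypothesis HFq : is_subfield Fq.

Lemma Fq1 : 1 \in Fq. Proof. by case: HFq. Qed.

Lemma FqB x y : x \in Fq -> y \in Fq -> x - y \in Fq.
Proof. by case: HFq => _ + _ _; apply. Qed.

Lemma FqM x y : x \in Fq -> y \in Fq -> x * y \in Fq.
Proof. by case: HFq => _ _ + _; apply. Qed.

Lemma FqV x : x \in Fq -> x^-1 \in Fq.
Proof. by case: HFq => _ _ _; apply. Qed.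

Lemma Fq0 : 0 \in Fq. Proof. by rewrite -(subrr 1) FqB ?Fq1. Qed.

Lemma FqN x : x \in Fq -> - x \in Fq.
Proof. by move=> Fx; rewrite -(sub0r x) FqB ?Fq0. Qed.

Lemma Fq_gt1 : (1 < #|Fq|)%N.
Proof.
by rewrite -[1%N]/(1.+1.-1) (cardD1 1) (cardD1 0) !inE Fq1 Fq0 eq_sym oner_neq0.
Qed.

(** For [x != 0], multiplication by [x] permutes the nonzero elements of [Fq], so the factor
    [x ^+ (#|Fq| - 1)] leaves their product unchanged. *)
Lemma Fq_exp x : x \in Fq -> x ^+ #|Fq| = x.
Proof.
move=> Fx; have [->|x0] := eqVneq x 0.
  by rewrite expr0n; move: Fq_gt1; case: #|_|.
have cF : #|Fq| = #|Fq :\ 0|.+1 by rewrite (cardsD1 0 Fq) Fq0.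
pose P := \prod_(y in Fq :\ 0) y.
have P0 : P != 0 by apply/prodf_neq0 => y; rewrite !inE => /andP[].
have inj : injective ( *%R x) by apply: mulfI.
have im : [set x * y | y in Fq :\ 0] = Fq :\ 0.
  apply/eqP; rewrite eqEcard card_imset // leqnn andbT.
  apply/subsetP => _ /imsetP[y + ->]; rewrite !inE mulf_eq0 negb_or => /andP[y0 Fy].
  by rewrite x0 y0 FqM.
have : P * x ^+ #|Fq :\ 0| = P * 1.
  rewrite mulr1 -prodr_const mulrC /P -big_split /= -[in RHS]im big_imset //.
  by move=> y z _ _; apply: inj.
by move/(mulfI P0) => E; rewrite cF exprS E mulr1.
Qed.

(** The polynomial ['X^#|Fq| - 'X] has at most [#|Fq|] roots, and the elements of [Fq] already
    account for that many. *)
Lemma Fq_expE x : (x \in Fq) = (x ^+ #|Fq| == x).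
Proof.
apply/idP/eqP => [/Fq_exp //|xq]; apply/negPn/negP => nFx.
pose p : {poly L} := 'X^#|Fq| - 'X.
have sp : size p = #|Fq|.+1.
  by rewrite size_polyDl size_polyXn // size_polyN size_polyX ltnS Fq_gt1.
have p0 : p != 0 by rewrite -size_poly_eq0 sp.
have : (size (x :: enum Fq) < size p)%N.
  apply: max_poly_roots p0 _ _; last by rewrite /= mem_enum nFx enum_uniq.
  rewrite /= /root !hornerE xq subrr eqxx /=.
  by apply/allP => y; rewrite mem_enum => /Fq_exp Ey; rewrite /root !hornerE Ey subrr.
by rewrite sp /= -cardE ltnn.
Qed.

End Subfield.

(** * Linearized polynomials *)

Section LinearizedPolynomials.
Variables (L : finFieldType) (Fq : {set L}) (h : nat).
Hypothesis HFq : is_subfield Fq.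
Hypothesis Hq : exists p k : nat, prime p /\ #|Fq| = (p ^ k)%N.
Hypothesis h_gt0 : (0 < h)%N.
Hypothesis HcardL : #|L| = (#|Fq| ^ h)%N.
Local Notation q := #|Fq|.

Lemma frobD j (x y : L) : (x + y) ^+ (q ^ j) = x ^+ (q ^ j) + y ^+ (q ^ j).
Proof.
case: Hq => p [k [pp qE]]; apply: exprDn_pchar.
have pL : p \in [pchar L] by apply: (@card_finPcharP _ _ (k * h)); rewrite // HcardL qE expnM.
by rewrite (eq_pnat _ (pcharf_eq pL)) qE -expnM pnatX pnat_id.
Qed.

Lemma q_gt0 : (0 < q)%N. Proof. exact: ltnW (Fq_gt1 HFq). Qed.

Lemma frob0 j : (0 : L) ^+ (q ^ j) = 0.
Proof. by rewrite expr0n; have := expn_gt0 q j; rewrite q_gt0 /= lt0n => /negPf->. Qed.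

Lemma frobN j (x : L) : (- x) ^+ (q ^ j) = - x ^+ (q ^ j).
Proof. by apply/eqP; rewrite -addr_eq0 -frobD addNr frob0. Qed.

Lemma frobB j (x y : L) : (x - y) ^+ (q ^ j) = x ^+ (q ^ j) - y ^+ (q ^ j).
Proof. by rewrite frobD frobN. Qed.

Lemma frob_sum j r (F : 'I_r -> L) :
  (\sum_i F i) ^+ (q ^ j) = \sum_i F i ^+ (q ^ j).
Proof. exact: (big_morph _ (frobD j) (frob0 j)). Qed.

Lemma frob_inj j : injective (fun x : L => x ^+ (q ^ j)).
Proof.
move=> x y /eqP; rewrite -subr_eq0 -frobB expf_eq0 subr_eq0 => /andP[_ /eqP].
exact.
Qed.

Lemma frob_id j c : c \in Fq -> c ^+ (q ^ j) = c.
Proof.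
by move=> Fc; elim: j => [|j IH]; rewrite ?expr1 // expnS exprM Fq_exp.
Qed.

Lemma frobh (x : L) : x ^+ (q ^ h) = x.
Proof. by rewrite -HcardL expf_card. Qed.

Definition linz (g : nat -> L) (x : L) : L := \sum_(j < h) g j * x ^+ (q ^ j).

(** As an ordinary polynomial it has degree at most [q ^ h.-1], less than [#|L|], while every
    element of [L] is a root. *)
Lemma linz_eq0 g : (forall x, linz g x = 0) -> forall j, (j < h)%N -> g j = 0.
Proof.
move=> g0.
pose p : {poly L} := \sum_(j < h) g j *: 'X^(q ^ j).
have pE x : p.[x] = linz g x.
  by rewrite horner_sum; apply: eq_bigr => j _; rewrite hornerZ hornerXn.
have sp : (size p <= #|L|)%N.
  apply: leq_trans (size_sum _ _ _) _; apply/bigmax_leqP => j _.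
  apply: leq_trans (size_scale_leq _ _) _.
  by rewrite size_polyXn HcardL ltn_exp2l ?Fq_gt1.
have p0 : p = 0.
  apply/eqP/negPn/negP => nz.
  have := max_poly_roots (rs := enum L) nz; rewrite -cardE enum_uniq ltnNge sp.
  suff -> : all (root p) (enum L) by move/(_ isT isT).
  by apply/allP => x _; rewrite /root pE g0.
move=> j jh; have : p`_(q ^ j) = 0 by rewrite p0 coef0.
rewrite coef_sum (bigD1 (Ordinal jh)) //= coefZ coefXn eqxx mulr1 big1 ?addr0 //.
move=> i /eqP ij; rewrite coefZ coefXn eqn_exp2l ?Fq_gt1 //.
by case: eqP => [e|]; rewrite ?mulr0 //; case: ij; apply: val_inj.
Qed.

(** * Linear independence over [Fq] by counting *)

Definition indep r (e : nat -> L) : Prop :=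
  forall c : nat -> L, (forall i, c i \in Fq) -> \sum_(i < r) c i * e i = 0 ->
  forall i, (i < r)%N -> c i = 0.

Definition comb r (e : nat -> L) (f : {ffun 'I_r -> L}) : L := \sum_(i < r) f i * e i.

Lemma card_coefs r : #|[set f : {ffun 'I_r -> L} | f \in ffun_on (mem Fq)]| = (q ^ r)%N.
Proof. by rewrite cardsE card_ffun_on card_ord. Qed.

Definition extend r (f : {ffun 'I_r -> L}) (i : nat) : L :=
  if insub i is Some j then f j else 0.

Lemma extendE r (f : {ffun 'I_r -> L}) (i : 'I_r) : extend f i = f i.
Proof. by rewrite /extend valK. Qed.

Lemma extend_Fq r (f : {ffun 'I_r -> L}) i : f \in ffun_on (mem Fq) -> extend f i \in Fq.
Proof. by move=> /ffun_onP Ff; rewrite /extend; case: insubP => [j _ _|_]; rewrite ?Ff ?Fq0. Qed.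

(** Pigeonhole: there are [q ^ r] coefficient vectors but only [q ^ h] values, so two combinations
    collide, and their difference is the relation. *)
Lemma dependent r (e : nat -> L) : (h < r)%N ->
  exists c : nat -> L, [/\ forall i, c i \in Fq, \sum_(i < r) c i * e i = 0 &
     exists2 i, (i < r)%N & c i != 0].
Proof.
move=> hr; pose D := [set f : {ffun 'I_r -> L} | f \in ffun_on (mem Fq)].
have : ~~ [forall f in D, forall g in D, (comb e f == comb e g) ==> (f == g)].
  apply/negP => /forall_inP inj.
  have : (#|comb e @: D| <= #|L|)%N by apply: max_card.
  rewrite card_in_imset => [|f g fD gD fg]; last first.
    by have /forall_inP/(_ g gD)/implyP/(_ (introT eqP fg))/eqP := inj f fD.
  by rewrite card_coefs HcardL leq_exp2l ?Fq_gt1 // leqNgt hr.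
rewrite negb_forall => /existsP[f]; rewrite negb_imply => /andP[fD].
rewrite negb_forall => /existsP[g]; rewrite negb_imply => /andP[gD].
rewrite negb_imply => /andP[/eqP fg nfg]; move: fD gD; rewrite !inE => fD gD.
exists (fun i => extend f i - extend g i); split => [i||].
- by rewrite FqB ?extend_Fq.
- transitivity (comb e f - comb e g); last by rewrite fg subrr.
  by rewrite -sumrB; apply: eq_bigr => i _; rewrite !extendE mulrBl.
- have [i fgi] : exists i, f i != g i.
    apply/existsP; rewrite -negb_forall; apply: contra nfg => /'forall_eqP E.
    by apply/eqP/ffunP.
  by exists i; rewrite // !extendE subr_eq0.
Qed.

Lemma card_span r (e : nat -> L) : (#|[set comb e f | f : {ffun 'I_r -> L} in
   [set f | f \in ffun_on (mem Fq)]]| <= q ^ r)%N.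
Proof. by rewrite -card_coefs leq_imset_card. Qed.

Lemma indep_extend r (e : nat -> L) x : indep r e ->
  x \notin [set comb e f | f : {ffun 'I_r -> L} in [set f | f \in ffun_on (mem Fq)]] ->
  indep r.+1 (fun i => if i == r then x else e i).
Proof.
move=> ie xS c Fc; rewrite big_ord_recr /= eqxx.
rewrite (eq_bigr (fun i : 'I_r => c i * e i)) => [s0|i _]; last by rewrite ltn_eqF.
have cr : c r = 0.
  apply/eqP/negPn/negP => cr; move/negP: xS; apply; apply/imsetP.
  exists [ffun i : 'I_r => - (c r)^-1 * c i].
    by rewrite inE; apply/ffun_onP => i; rewrite ffunE FqM ?FqN ?FqV.
  apply: (mulfI cr); rewrite /comb.
  rewrite (eq_bigr (fun i : 'I_r => - (c r)^-1 * (c i * e i))) => [|i _].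
    by rewrite -mulr_sumr mulrA mulrN divff // mulN1r; apply/eqP; rewrite -addr_eq0 addrC s0.
  by rewrite ffunE mulrA.
move=> i; rewrite ltnS leq_eqVlt => /predU1P[->//|]; apply: ie => //.
by move: s0; rewrite cr mul0r addr0.
Qed.

(** Greedy choice: fewer than [h] elements span at most [q ^ h.-1] elements, one of which is [0], so
    the span cannot contain [A]. *)
Lemma indep_exists (A : {set L}) : 0 \notin A -> (q ^ h.-1 <= #|A|)%N ->
  exists e : nat -> L, (forall i, (i < h)%N -> e i \in A) /\ indep h e.
Proof.
move=> A0 cA; suff: forall r, (r <= h)%N ->
   exists e : nat -> L, (forall i, (i < r)%N -> e i \in A) /\ indep r e by apply.
elim=> [_|r IH rh]; first by exists (fun _ => 0).
have [e [eA ie]] := IH (ltnW rh).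
pose S := [set comb e f | f : {ffun 'I_r -> L} in [set f | f \in ffun_on (mem Fq)]].
have S0 : 0 \in S.
  apply/imsetP; exists [ffun=> 0]; last by rewrite /comb big1 // => i _; rewrite ffunE mul0r.
  by rewrite inE; apply/ffun_onP => i; rewrite ffunE Fq0.
have [x xA xS] : exists2 x, x \in A & x \notin S.
  apply/subsetPn/negP => AS.
  have : (#|0%R |: A| <= #|S|)%N by apply: subset_leq_card; rewrite subUset sub1set S0.
  rewrite cardsU1 A0 /= leqNgt => /negP; apply.
  apply: leq_ltn_trans (card_span r e) _; rewrite add1n ltnS; apply: leq_trans cA.
  by rewrite leq_pexp2l ?q_gt0 // -ltnS prednK.
exists (fun i => if i == r then x else e i); split; last exact: indep_extend.
by move=> i; rewrite ltnS leq_eqVlt => /predU1P[->|ir]; rewrite ?eqxx // ltn_eqF ?eA.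
Qed.

Lemma indep_span (e : nat -> L) : indep h e ->
  forall x, exists2 c : nat -> L, forall i, c i \in Fq & x = \sum_(i < h) c i * e i.
Proof.
move=> ie x.
pose D := [set f : {ffun 'I_h -> L} | f \in ffun_on (mem Fq)].
have xS : x \in [set comb e f | f : {ffun 'I_h -> L} in D].
  apply/negPn/negP => /(indep_extend ie) ie'.
  have [c [Fc s0 [i ih]]] := dependent (fun i => if i == h then x else e i) (leqnn h.+1).
  by rewrite (ie' c) ?eqxx.
case/imsetP: xS => f; rewrite inE => fD ->; exists (extend f) => [i|].
  exact: extend_Fq.
by apply: eq_bigr => i _; rewrite extendE.
Qed.

(** * [Fq]-linear maps: polynomial form, semilinear and rigid ones *)

Definition Fq_lin (f : L -> L) : Prop :=
  (forall x y, f (x + y) = f x + f y) /\ (forall c x, c \in Fq -> f (c * x) = c * f x).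

Lemma Fq_lin0 f : Fq_lin f -> f 0 = 0.
Proof. by case=> fD _; apply: (addrI (f 0)); rewrite -fD !addr0. Qed.

Lemma Fq_lin_comb f r (c e : nat -> L) : Fq_lin f -> (forall i, c i \in Fq) ->
  f (\sum_(i < r) c i * e i) = \sum_(i < r) c i * f (e i).
Proof.
move=> lf Fc; rewrite (big_morph f (proj1 lf) (Fq_lin0 lf)).
by apply: eq_bigr => i _; rewrite (proj2 lf).
Qed.

Lemma linz_lin g : Fq_lin (linz g).
Proof.
split=> [x y|c x Fc]; rewrite /linz.
  by rewrite -big_split; apply: eq_bigr => j _; rewrite frobD mulrDr.
by rewrite mulr_sumr; apply: eq_bigr => j _; rewrite exprMn frob_id // mulrCA.
Qed.

(** Evaluation on an [Fq]-basis sends coefficient vectors to value vectors. It is an injective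
    self-map of the finite set of [h]-tuples over [L], hence surjective. *)
Lemma Fq_linP f : Fq_lin f -> exists g, forall x, f x = linz g x.
Proof.
move=> lf; have [e [_ ie]] : exists e : nat -> L,
    (forall i, (i < h)%N -> e i \in [set~ 0]) /\ indep h e.
  apply: indep_exists; first by rewrite !inE eqxx.
  have := cardsC [set (0 : L)]; rewrite cards1 add1n HcardL -ltnS => ->.
  by rewrite ltn_exp2l ?Fq_gt1 // prednK.
have se := indep_span ie.
pose T (g : {ffun 'I_h -> L}) : {ffun 'I_h -> L} := [ffun i : 'I_h => linz (extend g) (e i)].
have Tinj : injective T.
  move=> g g' /ffunP Tg; apply/ffunP => i; apply/eqP; rewrite -subr_eq0; apply/eqP.
  have dE x : linz (fun i => extend g i - extend g' i) x = linz (extend g) x - linz (extend g') x.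
    by rewrite /linz -sumrB; apply: eq_bigr => j _; rewrite mulrBl.
  rewrite -!extendE; apply: (@linz_eq0 (fun i => extend g i - extend g' i)) (ltn_ord i) => x.
  have [c Fc ->] := se x.
  rewrite Fq_lin_comb //; last exact: linz_lin.
  rewrite big1 // => k _; rewrite dE; have := Tg k; rewrite !ffunE => ->.
  by rewrite subrr mulr0.
have [T' _ TK] := injF_bij Tinj.
pose g := T' [ffun i : 'I_h => f (e i)].
exists (extend g) => x; have [c Fc ->] := se x.
rewrite !Fq_lin_comb //; last exact: linz_lin.
apply: eq_bigr => i _; congr (_ * _).
by have /ffunP/(_ i) := TK [ffun i : 'I_h => f (e i)]; rewrite !ffunE.
Qed.

Definition semilin (M : L -> L) : Prop :=
  exists tau : L -> L, forall c x, M (c * x) = tau c * M x.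

Lemma linz_single (g : nat -> L) (j : 'I_h) : (forall k : 'I_h, k != j -> g k = 0) ->
  semilin (linz g).
Proof.
move=> g0; exists (fun c => c ^+ (q ^ j)) => c x.
have E y : linz g y = g j * y ^+ (q ^ j).
  by rewrite /linz (bigD1 j) //= big1 ?addr0 // => k /g0->; rewrite mul0r.
by rewrite !E exprMn mulrCA.
Qed.

Lemma semilin_ext M M' : M =1 M' -> semilin M -> semilin M'.
Proof. by move=> E [tau Ht]; exists tau => c x; rewrite -!E. Qed.

Definition rigid (M : L -> L) : Prop :=
  forall c b, (forall x, M (c * x) = b * M x) -> c \in Fq /\ b = c.

Lemma linz_coef2 g g' : (forall x, linz g x = linz g' x) ->
  forall j, (j < h)%N -> g j = g' j.
Proof.
move=> gg' j jh; apply/eqP; rewrite -subr_eq0; apply/eqP.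
apply: (@linz_eq0 (fun j => g j - g' j)) jh => x.
transitivity (linz g x - linz g' x); last by rewrite gg' subrr.
by rewrite /linz -sumrB; apply: eq_bigr => k _; rewrite mulrBl.
Qed.

(** For [h <= 3] the number [d] is coprime to [h], so an element fixed by the powers [q ^ d] and
    [q ^ h] is fixed by the power [q]. *)
Lemma frob_fixed c d : (0 < d < h)%N -> (h <= 3)%N -> c ^+ (q ^ d) = c -> c \in Fq.
Proof.
move=> dh h3 E; rewrite (Fq_expE HFq); apply/eqP.
have [d1|[d2 hE]] : d = 1%N \/ (d = 2%N /\ h = 3%N) by lia.
  by rewrite d1 expn1 in E.
by have := frobh c; rewrite hE expnSr exprM -d2 E.
Qed.

(** Nonzero coefficients at two indices [i < j] turn [M (c * x) = b * M x] into
    [c ^+ (q ^ i) = b = c ^+ (q ^ j)], and [frob_fixed] applies with [j - i]. Otherwise at most one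
    monomial is left. *)
Lemma semilin_or_rigid M : (h <= 3)%N -> Fq_lin M -> semilin M \/ rigid M.
Proof.
move=> h3 /Fq_linP[g Mg].
have [/existsP[i /existsP[j /and3P[ij gi gj]]]|] :=
  boolP [exists i : 'I_h, exists j : 'I_h, [&& (i < j)%N, g i != 0 & g j != 0]].
  right=> c b E.
  have cE (k : 'I_h) : g k != 0 -> c ^+ (q ^ k) = b.
    move=> gk; apply: (mulfI gk); rewrite [RHS]mulrC.
    apply: (@linz_coef2 (fun k => g k * c ^+ (q ^ k)) (fun k => b * g k) _ _ (ltn_ord k)) => x.
    transitivity (M (c * x)).
      by rewrite Mg; apply: eq_bigr => l _; rewrite exprMn mulrA.
    by rewrite E Mg mulr_sumr; apply: eq_bigr => l _; rewrite mulrA.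
  have Fc : c \in Fq.
    apply: (@frob_fixed c (j - i)%N) => //; first by have := ltn_ord j; lia.
    apply: (@frob_inj i); rewrite /= -exprM -expnD subnK; last by lia.
    by rewrite !cE.
  by split=> //; rewrite -(cE i gi) frob_id.
rewrite negb_exists => /forallP E; left; apply: semilin_ext (fsym Mg) _.
have {}E (i j : 'I_h) : i != j -> g i != 0 -> g j = 0.
  move=> ij gi; apply/eqP/negPn/negP => gj.
  wlog ltij : i j ij gi gj / (i < j)%N.
    move=> W; case: (ltngtP i j) => [|ji|/val_inj e].
    - exact: W.
    - by apply: (W j i); rewrite // eq_sym.
    - by rewrite e eqxx in ij.
  by have := E i; rewrite negb_exists => /forallP/(_ j); rewrite ltij gi gj.
have [/existsP[i gi]|] := boolP [exists i : 'I_h, g i != 0].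
  by apply: (@linz_single g i) => k ki; apply: (E i); rewrite // eq_sym.
rewrite negb_exists => /forallP g0.
apply: (@linz_single g (Ordinal h_gt0)) => k _.
by apply/eqP; have := g0 k; rewrite negbK.
Qed.

(** This is the trace of [L] over [Fq]: the [q]-th power permutes its summands cyclically. *)
Lemma trace_Fq y : linz (fun=> 1) y \in Fq.
Proof.
rewrite (Fq_expE HFq); apply/eqP; rewrite -{1}(expn1 q) frob_sum.
rewrite /linz; case: h h_gt0 frobh => [//|k] _ fh.
rewrite big_ord_recr [RHS]big_ord_recl /= addrC; congr (_ + _).
  by rewrite !mul1r expn1 -exprM -expnSr fh expr1.
by apply: eq_bigr => i _; rewrite !mul1r -exprM -expnD addn1.
Qed.

(* Pairing with the trace form turns the relation into Fq-linear relations
   among the a i. *)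
Lemma tensor_inj (g : nat -> L) r (a s : nat -> L) :
  (forall j, (j < h)%N -> g j != 0) -> indep r a ->
  (forall x, \sum_(i < r) a i * linz g (s i * x) = 0) ->
  forall i, (i < r)%N -> s i = 0.
Proof.
move=> g0 ia E.
have E1 j : (j < h)%N -> \sum_(i < r) a i * s i ^+ (q ^ j) = 0.
  move=> jh; apply: (mulfI (g0 j jh)); rewrite mulr0.
  apply: (@linz_eq0 (fun j => g j * \sum_(i < r) a i * s i ^+ (q ^ j)) _ _ jh) => x.
  rewrite -[RHS](E x) /linz.
  under [RHS]eq_bigr do rewrite mulr_sumr.
  rewrite exchange_big; apply: eq_bigr => k _.
  rewrite mulr_sumr mulr_suml; apply: eq_bigr => i _.
  by rewrite exprMn !mulrA [_ * g k]mulrC.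
(* Summing [E1] times [t ^+ (q ^ j)] over [j] gives a relation among the [a i] whose coefficients
   are the traces of the [t * s i]. *)
have T0 t i : (i < r)%N -> linz (fun=> 1) (t * s i) = 0.
  apply: (ia (fun i => linz (fun=> 1) (t * s i))) => [k|]; first exact: trace_Fq.
  under eq_bigr do rewrite /linz mulr_suml.
  rewrite exchange_big big1 //= => j _.
  under eq_bigr do rewrite mul1r exprMn -mulrA [_ * a _]mulrC.
  by rewrite -mulr_sumr E1 ?mulr0.
move=> i ir; apply/eqP/negPn/negP => si.
have E2 x : linz (fun=> 1) x = 0 by rewrite -(divfK si x) T0.
by have/eqP := @linz_eq0 (fun=> 1) E2 0%N h_gt0; rewrite oner_eq0.
Qed.

Lemma indep_nprop r e i l m : indep r e -> (i < r)%N -> (l < r)%N -> i != l ->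
  m \in Fq -> e i != m * e l.
Proof.
move=> ie ir lr il Fm; apply/eqP => E.
pose c k : L := if k == i then 1 else if k == l then - m else 0.
have : c i = 0.
  apply: (ie c) => // [k|].
    by rewrite /c; do 2?case: ifP => _; rewrite ?Fq1 ?FqN ?Fq0.
  rewrite (bigD1 (Ordinal ir)) //= (bigD1 (Ordinal lr)) /=; last first.
    by rewrite -val_eqE eq_sym.
  rewrite big1 => [|k /andP[]].
    by rewrite /c !eqxx eq_sym (negPf il) E mul1r mulNr addr0 subrr.
  by rewrite -!val_eqE /c /= => /negPf-> /negPf->; rewrite mul0r.
by rewrite /c eqxx => /eqP; rewrite oner_eq0.
Qed.

(** * The relation [a j * G (c j * x) = H (b j * K x)] *)

Section ScalarRelation.
Variables (J : finType) (a b c : J -> L) (G H K : L -> L).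
Hypotheses (a0 : forall j, a j != 0) (b0 : forall j, b j != 0) (c0 : forall j, c j != 0).
Hypothesis a_inj : injective a.
Hypotheses (linG : Fq_lin G) (linH : Fq_lin H) (K' : L -> L) (K'K : cancel K' K).
Hypothesis GHK : forall j x, a j * G (c j * x) = H (b j * K x).

(** Comparing the relations at [i] and [j] shows that [H] turns multiplication by [b i / b j] into
    multiplication by [l * a i / a j]; rigidity puts the latter scalar in [Fq]. *)
Lemma proportional_ca i j l : rigid H -> l \in Fq -> c i = l * c j ->
  exists2 m, m \in Fq & a i = m * a j.
Proof.
move=> rH Fl cE; have l0 : l != 0.
  by apply/eqP => l0; have := c0 i; rewrite cE l0 mul0r eqxx.
have E x : H (b i / b j * x) = l * a i / a j * H x.
  have -> : H x = a j * G (c j * K' (x / b j)).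
    by rewrite GHK K'K mulrC divfK.
  have -> : b i / b j * x = b i * K (K' (x / b j)) by rewrite K'K; ring.
  rewrite -GHK cE -(mulrA l (c j)) (proj2 linG) //.
  by field.
have [FB AB] := rH _ _ E; exists (l * a i / a j / l).
  by rewrite FqM ?FqV // AB.
by field; rewrite a0 l0.
Qed.

(** The bound with [q ^ h.-1] supplies a basis among the [a j]; the bound with [h * q.-1] supplies
    one more that is no [Fq]-multiple of a basis element. *)
Lemma no_generic_relation (g : nat -> L) : G =1 linz g ->
  (forall j, (j < h)%N -> g j != 0) -> rigid H ->
  (q ^ h.-1 <= #|J|)%N -> (h * q.-1 < #|J|)%N -> False.
Proof.
move=> Gg g0 rH J1 J2.
have J0 : (0 < #|J|)%N by apply: leq_trans J2.
have /card_gt0P[j0 _] := J0.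
have [e [eA ie]] : exists e : nat -> L,
    (forall i, (i < h)%N -> e i \in [set a j | j : J]) /\ indep h e.
  apply: indep_exists; last by rewrite card_imset.
  by apply/imsetP => -[j _ /eqP]; rewrite eq_sym (negPf (a0 j)).
pose t i := odflt j0 [pick j | a j == e i].
have te i : (i < h)%N -> a (t i) = e i.
  move=> /eA/imsetP[j _ ej]; rewrite /t; case: pickP => [k /eqP //|/(_ j)].
  by rewrite ej eqxx.
pose U := [set p.1 * e p.2 | p : L * 'I_h in setX (Fq :\ 0) [set: 'I_h]].
have [_ /imsetP[j4 _ ->] j4U] : exists2 x, x \in [set a j | j : J] & x \notin U.
  apply/subsetPn/negP => /subset_leq_card; rewrite card_imset // leqNgt => /negP; apply.
  apply: leq_ltn_trans (leq_imset_card _ _) _.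
  rewrite cardsX cardsT card_ord mulnC; apply: leq_trans J2.
  by rewrite ltnS leq_mul2l [X in (_ <= X.-1)%N](cardsD1 0 Fq) Fq0 //= leqnn orbT.
pose T i := if i == h then j4 else t i.
have [y [Fy]] := dependent (fun i => b (T i)) (ltnSn h).
rewrite big_ord_recr /= {2}/T eqxx.
rewrite (eq_bigr (fun i : 'I_h => y i * b (t i))); last first.
  by move=> i _; rewrite /T ltn_eqF.
move=> by0 [i0 i0h yi0].
have [al Fal a4] := indep_span ie (a j4).
(* Multiply the dependency among the [b (T i)] by [K x], apply [H], and expand [a j4] in the basis
   [e]. *)
have E x : \sum_(i < h) e i * linz g ((y i * c (t i) + al i * y h * c j4) * x) = 0.
  rewrite -[RHS](Fq_lin0 linH) -[X in _ = H X](mul0r (K x)) -[X in _ = H (X * _)]by0.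
  rewrite mulrDl mulr_suml (proj1 linH).
  rewrite (big_morph H (proj1 linH) (Fq_lin0 linH)) -mulrA (proj2 linH) // -GHK.
  rewrite a4 mulr_suml mulr_sumr -big_split; apply: eq_bigr => i _ /=.
  rewrite -Gg mulrDl (proj1 linG) -(mulrA (y i) _ x) (proj2 linG) //.
  rewrite -(mulrA (al i * y h) _ x) (proj2 linG (al i * y h)) ?FqM //.
  rewrite -(mulrA (y i) _ (K x)) (proj2 linH) // -GHK te //.
  by ring.
have S0 := @tensor_inj g h e (fun i => y i * c (t i) + al i * y h * c j4) g0 ie E.
have yh : y h != 0.
  apply/eqP => yh; have := yi0; move: i0h; rewrite ltnS leq_eqVlt => /predU1P[->|ih].
    by rewrite yh eqxx.
  have := S0 _ ih; rewrite yh mulr0 mul0r addr0 => /eqP.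
  by rewrite mulf_eq0 (negPf (c0 _)) orbF => ->.
have ynz i : (i < h)%N -> al i != 0 -> y i != 0.
  move=> ih ali; apply/eqP => yi; have := S0 _ ih; rewrite yi mul0r add0r => /eqP.
  by rewrite !mulf_eq0 (negPf ali) (negPf yh) (negPf (c0 _)).
have [i ali] : exists i : 'I_h, al i != 0.
  apply/existsP; rewrite -[X in is_true X]negbK negb_exists; apply/negP => /forallP n0.
  have := a0 j4; rewrite a4 big1 ?eqxx // => i _.
  by have := n0 i; rewrite negbK => /eqP->; rewrite mul0r.
(* With a single nonzero coordinate, [a j4] would lie in [U]. *)
have [l /andP[li all]] : exists l : 'I_h, (l != i) && (al l != 0).
  apply/existsP; rewrite -[X in is_true X]negbK negb_exists; apply/negP => /forallP n0.
  move/negP: j4U; apply; apply/imsetP; exists (al i, i); first by rewrite !inE ali Fal.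
  rewrite a4 (bigD1 i) //= big1 ?addr0 // => k ki.
  by have := n0 k; rewrite ki negbK => /eqP->; rewrite mul0r.
have cE : c (t i) = (al i / y i * (y l / al l)) * c (t l).
  have Ei := S0 _ (ltn_ord i); have El := S0 _ (ltn_ord l).
  have yi := ynz _ (ltn_ord i) ali.
  apply: (mulfI yi); apply: (mulIf all).
  transitivity (al i * (y l * c (t l))); last by field; rewrite yi all.
  have -> : y l * c (t l) = - (al l * y h * c j4) by apply/eqP; rewrite -addr_eq0 El.
  have -> : y i * c (t i) = - (al i * y h * c j4) by apply/eqP; rewrite -addr_eq0 Ei.
  by ring.
have [|m Fm] := proportional_ca rH _ cE; first by rewrite !FqM ?FqV.
rewrite !te // => /eqP; apply/negP; apply: indep_nprop ie _ _ _ Fm => //.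
by rewrite eq_sym.
Qed.

End ScalarRelation.

(** Two cyclically adjacent monomials; factoring out the twist [x ^+ (q ^ i)] leaves a map of degree
    [q]. *)
Definition two_term (M : L -> L) : Prop := exists i u v,
  [/\ (i <= h)%N, u != 0, v != 0 &
      forall x, M x = u * x ^+ (q ^ i) + v * (x ^+ (q ^ i)) ^+ q].

(** The cases count nonzero coefficients. For [h = 3] any two indices are adjacent modulo [3], since
    [x ^+ (q ^ 3) = x]. *)
Lemma linz_cases (g : nat -> L) : h = 2%N \/ h = 3%N ->
  [\/ semilin (linz g), forall j, (j < h)%N -> g j != 0 | h = 3%N /\ two_term (linz g)].
Proof.
case=> hE.
  have [g0|g0] := eqVneq (g 0%N) 0.
    have h1 : (1 < h)%N by rewrite hE.
    apply: Or31; apply: (@linz_single g (Ordinal h1)) => -[[|[|k]] kh] //; lia.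
  have [g1|g1] := eqVneq (g 1%N) 0; last by apply: Or32 => -[|[|j]] //; lia.
  apply: Or31; apply: (@linz_single g (Ordinal h_gt0)) => -[[|[|k]] kh] //; lia.
have [h1 h2] : (1 < h)%N /\ (2 < h)%N by rewrite hE.
have gE x : linz g x = g 0%N * x + g 1%N * x ^+ q + g 2%N * x ^+ (q ^ 2).
  by rewrite /linz hE !big_ord_recl big_ord0 /= expn0 expn1 expr1 addr0 addrA.
have [g0|g0] := eqVneq (g 0%N) 0; have [g1|g1] := eqVneq (g 1%N) 0;
  have [g2|g2] := eqVneq (g 2%N) 0.
- by apply: Or31; apply: (@linz_single g (Ordinal h1)) => -[[|[|[|k]]] kh] //; lia.
- by apply: Or31; apply: (@linz_single g (Ordinal h2)) => -[[|[|[|k]]] kh] //; lia.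
- by apply: Or31; apply: (@linz_single g (Ordinal h1)) => -[[|[|[|k]]] kh] //; lia.
- apply: Or33; split=> //; exists 1%N, (g 1%N), (g 2%N); split=> // x.
  by rewrite gE g0 mul0r add0r expn1 -exprM mulnn.
- by apply: Or31; apply: (@linz_single g (Ordinal h_gt0)) => -[[|[|[|k]]] kh] //; lia.
- apply: Or33; split=> //; exists 2%N, (g 2%N), (g 0%N); split=> // x.
  by rewrite gE g1 mul0r addr0 -exprM -expnSr -hE frobh addrC.
- apply: Or33; split=> //; exists 0%N, (g 0%N), (g 1%N); split=> // x.
  by rewrite gE g2 mul0r addr0 expn0 expr1.
- by apply: Or32 => -[|[|[|j]]] //; lia.
Qed.

Lemma frob_in j z : z ^+ (q ^ j) \in Fq -> z \in Fq.
Proof.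
rewrite !(Fq_expE HFq) => /eqP E; apply/eqP; apply: (@frob_inj j).
by rewrite /= -exprM mulnC exprM.
Qed.

(* Comparing the coefficients of X^(q^2): the left-hand side has none. *)
Lemma special_relation (J : finType) (a b c : J -> L) (K : L -> L) (u v u' v' : L) :
  h = 3%N -> u' != 0 -> v' != 0 -> (forall j, b j != 0) -> Fq_lin K -> (0 < #|J|)%N ->
  (forall j x, a j * (u * (c j * x) + v * (c j * x) ^+ q) =
               u' * (b j * K x) + v' * (b j * K x) ^+ q) ->
  (exists m, forall x, K x = m * x) \/ (forall i j, b i / b j \in Fq).
Proof.
move=> hE u0 v0 b0 /Fq_linP[m Km] /card_gt0P[j0 _] E.
have mE x : K x = m 0%N * x + m 1%N * x ^+ q + m 2%N * x ^+ (q ^ 2).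
  by rewrite Km /linz hE !big_ord_recl big_ord0 /= expn0 expn1 expr1 addr0 addrA.
have D (x y : L) : (x + y) ^+ q = x ^+ q + y ^+ q by have := frobD 1 x y; rewrite expn1.
(* The [k]'s are the coefficients of the right-hand side minus the left-hand side; the [q]-th power
   of the last term of [K] wraps round to degree one. *)
have C2 j : u' * b j * m 2%N + v' * b j ^+ q * m 1%N ^+ q = 0.
  pose k0 := u' * b j * m 0%N + v' * b j ^+ q * m 2%N ^+ q - a j * u * c j.
  pose k1 := u' * b j * m 1%N + v' * b j ^+ q * m 0%N ^+ q - a j * v * c j ^+ q.
  pose k2 := u' * b j * m 2%N + v' * b j ^+ q * m 1%N ^+ q.
  apply: (@linz_eq0 (fun k => nth 0 [:: k0; k1; k2] k) _ 2%N); last by rewrite hE.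
  move=> x; rewrite /linz hE !big_ord_recl big_ord0 /= expn0 expn1 expr1 addr0.
  have := E j x; rewrite mE !exprMn !D !exprMn -!exprM -expnSr -hE frobh => /eqP.
  rewrite -subr_eq0 => /eqP e; apply: oppr_inj; rewrite oppr0 -e /k0 /k1 /k2.
  by rewrite -mulnn; ring.
have [m2|m2] := eqVneq (m 2%N) 0.
  have m1 : m 1%N = 0.
    have /eqP := C2 j0; rewrite m2 mulr0 add0r !mulf_eq0 (negPf v0) !expf_eq0.
    by rewrite (negPf (b0 _)) !andbF /= => /andP[_ /eqP].
  by left; exists (m 0%N) => x; rewrite mE m1 m2 !mul0r !addr0.
right=> i j; rewrite (Fq_expE HFq) expr_div_n.
have m1 : v' * m 1%N ^+ q != 0.
  rewrite mulf_neq0 // expf_neq0 //; apply/eqP => m1; have /eqP := C2 j.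
  rewrite m1 expr0n (negPf (lt0n_neq0 q_gt0)) mulr0 addr0 !mulf_eq0.
  by rewrite (negPf u0) (negPf (b0 _)) (negPf m2).
(* The [q]-th power multiplies every [b k] by the same constant, so it fixes their quotients. *)
have B k : b k ^+ q = - (u' * m 2%N / (v' * m 1%N ^+ q)) * b k.
  apply: (mulfI m1); apply/eqP; rewrite -subr_eq0 -(C2 k); apply/eqP; field.
  by move: m1; rewrite mulf_eq0 negb_or andbC.
have B0 : - (u' * m 2%N / (v' * m 1%N ^+ q)) != 0 by rewrite oppr_eq0 !mulf_neq0 ?invr_eq0.
by rewrite !B -mulf_div divff ?mul1r.
Qed.

Theorem semilinear_relation (J : finType) (a b c : J -> L) (G H K K' : L -> L) :
  h = 2%N \/ h = 3%N ->
  (forall j, a j != 0) -> (forall j, b j != 0) -> (forall j, c j != 0) ->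
  injective a -> injective b -> Fq_lin G -> Fq_lin H -> Fq_lin K ->
  cancel K K' -> cancel K' K ->
  (forall j x, a j * G (c j * x) = H (b j * K x)) ->
  (q ^ h.-1 <= #|J|)%N -> (h * q.-1 < #|J|)%N ->
  [\/ semilin G, semilin H | semilin K].
Proof.
move=> h23 a0 b0 c0 ai bi lG lH lK KK' K'K E J1 J2.
have h3 : (h <= 3)%N by case: h23 => ->.
have [sG|rG] := semilin_or_rigid h3 lG; first exact: Or31.
have [sH|rH] := semilin_or_rigid h3 lH; first exact: Or32.
have [g Gg] := Fq_linP lG; have [g' Hg] := Fq_linP lH.
have [sG|gn|[hE [i [u [v [ih u0 v0 GE]]]]]] := linz_cases g h23.
- by apply: Or31; apply: semilin_ext sG => x.
- by case: (no_generic_relation a0 b0 c0 ai lG lH K'K E Gg gn rH J1 J2).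
have [sH|gn|[_ [l [u' [v' [lh u0' v0' HE]]]]]] := linz_cases g' h23.
- by apply: Or32; apply: semilin_ext sH => x.
(* Solving the relation for [G (c j * K' x)] exchanges [G] with [H], [b] with [c] and [K] with [K'],
   and inverts [a]. *)
- case: (@no_generic_relation J (fun j => (a j)^-1) c b H G K' _ c0 b0 _ lH lG K KK' _
    g' Hg gn rG J1 J2).
  + by move=> j; rewrite invr_eq0.
  + by move=> j k /invr_inj/ai.
  + by move=> j x; rewrite -{1}(K'K x) -E mulKf.
have iK (x : L) : (x ^+ (q ^ (h - i))) ^+ (q ^ i) = x by rewrite -exprM -expnD subnK // frobh.
have lK' (x : L) : (x ^+ (q ^ (h - l))) ^+ (q ^ l) = x by rewrite -exprM -expnD subnK // frobh.
(* [M] absorbs the Frobenius twists of [G] and [H], leaving outer maps of degree [q]. *)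
pose M y := K (y ^+ (q ^ (h - i))) ^+ (q ^ l).
have lM : Fq_lin M.
  split=> [x y|d x Fd]; first by rewrite /M frobD (proj1 lK) frobD.
  by rewrite /M exprMn (frob_id _ Fd) (proj2 lK) // exprMn (frob_id _ Fd).
have J0 : (0 < #|J|)%N by apply: leq_trans J2.
have EM j x : a j * (u * (c j ^+ (q ^ i) * x) + v * (c j ^+ (q ^ i) * x) ^+ q) =
    u' * (b j ^+ (q ^ l) * M x) + v' * (b j ^+ (q ^ l) * M x) ^+ q.
  by rewrite -{1 2}(iK x) /M -!(exprMn (q ^ i)) -!(exprMn (q ^ l)) -GE -HE -Gg -Hg E.
have bl j : b j ^+ (q ^ l) != 0 by rewrite expf_neq0.
have [[m Mm]|B] := special_relation hE u0' v0' bl lM J0 EM.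
  apply: Or33; exists (fun d => (d ^+ (q ^ i)) ^+ (q ^ (h - l))) => d x.
  have Kx y : K y ^+ (q ^ l) = m * y ^+ (q ^ i).
    by rewrite -Mm /M -exprM mulnC exprM iK.
  by apply: (@frob_inj l); rewrite /= [RHS]exprMn lK' !Kx exprMn mulrCA.
exfalso.
have /card_gt0P[j0 _] := J0.
(* All quotients [b j / b j0] lie in [Fq], so [#|J| <= q], whereas [#|J|] is at least [q ^ 2]. *)
have : (#|[set b j / b j0 | j : J]| <= #|Fq|)%N.
  apply: subset_leq_card; apply/subsetP => _ /imsetP[j _ ->].
  by apply: (@frob_in l); rewrite expr_div_n B.
rewrite card_imset => [|j k /(divIf (b0 j0))/bi //].
apply/negP; rewrite -ltnNge; apply: leq_trans J1; rewrite hE /= -{1}(expn1 q).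
by rewrite ltn_exp2l ?Fq_gt1.
Qed.

End LinearizedPolynomials.

(** * Codes with linear projections *)

Section LinearBijections.
Variables (L : finFieldType) (Fq : {set L}).

Lemma lin_bij_lin f : Fq_linear_bij Fq f -> Fq_lin Fq f.
Proof. by case. Qed.

Lemma lin_bij_inv f : Fq_linear_bij Fq f ->
  exists g, [/\ Fq_linear_bij Fq g, cancel f g & cancel g f].
Proof.
case=> fD fZ [g fK gK]; exists g; split=> //; split; last by exists f.
  by move=> x y; apply: (can_inj fK); rewrite fD !gK.
by move=> c x Fc; apply: (can_inj fK); rewrite fZ ?gK.
Qed.

Lemma lin_bij_comp f g : Fq_linear_bij Fq f -> Fq_linear_bij Fq g ->
  Fq_linear_bij Fq (f \o g).
Proof.
move=> [fD fZ fb] [gD gZ gb]; split; last exact: bij_comp.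
  by move=> x y /=; rewrite gD fD.
by move=> c x Fc /=; rewrite gZ ?fZ.
Qed.

Lemma lin_bij_id : Fq_linear_bij Fq id.
Proof. by split=> //; exists id. Qed.
End LinearBijections.

(** * MDS codes determined by three positions *)

Section MDSCode.
Variables (L : finFieldType) (Fq : {set L}) (n : nat) (C : {set 'rV[L]_n}).
Hypothesis HlinC : Fq_linear Fq C.
Hypothesis HcardC : #|C| = (#|L| ^ 3)%N.
Hypothesis HdistC : min_dist C (n - 2).

Lemma C0 : 0 \in C. Proof. by case: HlinC. Qed.

Lemma CD u v : u \in C -> v \in C -> u + v \in C.
Proof. by case: HlinC => _ + _; apply. Qed.

Lemma CZ c u : c \in Fq -> u \in C -> c *: u \in C.
Proof. by case: HlinC => _ _; apply. Qed.

(** Distinct codewords differ in at least [n - 2] positions, so they agree in at most two. *)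
Lemma eq_codeword i k l u v : uniq [:: i; k; l] -> u \in C -> v \in C ->
  u 0 i = v 0 i -> u 0 k = v 0 k -> u 0 l = v 0 l -> u = v.
Proof.
move=> U Cu Cv ei ek el; apply/eqP/negPn/negP => uv.
have := (proj2 HdistC) u v Cu Cv uv; rewrite leqNgt => /negP; apply.
have c3 : #|[:: i; k; l]| = 3%N by apply/card_uniqP.
have : (hdist u v + #|[:: i; k; l]| <= n)%N.
  rewrite -[X in (_ <= X)%N]card_ord -(cardC (mem [:: i; k; l])) addnC leq_add2l.
  apply: subset_leq_card; apply/subsetP => j; rewrite !inE; apply: contraNN.
  by case/or3P => /eqP->; rewrite ?ei ?ek ?el.
by rewrite c3; lia.
Qed.

(** Reading three positions is injective on [C], which has [#|L| ^ 3] elements, hence onto. *)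
Lemma codeword_exists i k l x y z : uniq [:: i; k; l] ->
  exists2 v, v \in C & [/\ v 0 i = x, v 0 k = y & v 0 l = z].
Proof.
move=> U; pose T (v : 'rV[L]_n) := (v 0 i, v 0 k, v 0 l).
have : (x, y, z) \in T @: C.
  suff -> : T @: C = setT by rewrite inE.
  apply/eqP; rewrite eqEcard subsetT cardsT !card_prod card_in_imset.
    by rewrite /= HcardC !expnS expn0 muln1 mulnA leqnn.
  by move=> u v Cu Cv [? ? ?]; apply: (eq_codeword U).
by case/imsetP => v Cv [-> -> ->]; exists v.
Qed.

(** Suitable bijections make the codewords vanishing at [i] an [L]-linear code. There a scalar acts
    alike on all positions, so at [j] the words that also vanish at [l] and those that also vanish
    at [k] are compared by one scalar [b j]. *)
Lemma proj_linear i k l : uniq [:: i; k; l] -> Fq_equiv_to_linear Fq (proj C i) ->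
  exists Ek El (b : 'I_n -> L), [/\ Fq_linear_bij Fq Ek, Fq_linear_bij Fq El,
    forall j, j \notin [:: i; k; l] -> b j != 0,
    (forall j j', j \notin [:: i; k; l] -> j' \notin [:: i; k; l] -> b j = b j' -> j = j') &
    forall j y u v, j \notin [:: i; k; l] -> u \in C -> v \in C ->
      u 0 i = 0 -> u 0 l = 0 -> u 0 k = Ek y ->
      v 0 i = 0 -> v 0 k = 0 -> v 0 l = El (b j * y) -> u 0 j = v 0 j].
Proof.
move=> U [D [[_ _ DZ] [s [f [fb DE]]]]].
(* The bijection acting on position [j], found by undoing the deletion of [i] and the permutation
   [s]; the identity is the default at [i]. *)
pose F j := if unlift i j is Some m then f ((s^-1)%g m) else id.
have Fb j : Fq_linear_bij Fq (F j).
  by rewrite /F; case: unlift => *; [apply: fb | apply: lin_bij_id].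
have Finj j : injective (F j) by case: (Fb j) => _ _ /bij_inj.
have F0 j : F j 0 = 0 by apply: Fq_lin0; apply: lin_bij_lin (Fb j).
pose d (v : 'rV[L]_n) := \row_m f m (v 0 (lift i (s m))).
have dD v : v \in C -> v 0 i = 0 -> d v \in D.
  move=> Cv vi; rewrite DE; apply/imsetP; exists (\row_j v 0 (lift i j)).
    by apply/imsetP; exists v; rewrite // inE Cv vi eqxx.
  by apply/rowP => m; rewrite !mxE.
have Dd w : w \in D -> exists2 v, v \in C /\ v 0 i = 0 & w = d v.
  rewrite DE => /imsetP[v' /imsetP[v]]; rewrite inE => /andP[Cv /eqP vi] -> ->.
  by exists v => //; apply/rowP => m; rewrite !mxE.
(* The [a]-multiple of [d v] comes from a codeword [w], which agrees with [u] at [i], [k] and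
   [l]. *)
have scale a u v : u \in C -> v \in C -> u 0 i = 0 -> v 0 i = 0 ->
    (forall j, j \in [:: k; l] -> F j (u 0 j) = a * F j (v 0 j)) ->
    forall j, j != i -> F j (u 0 j) = a * F j (v 0 j).
  move=> Cu Cv ui vi E.
  have [w [Cw wi] wE] := Dd _ (DZ a _ (dD v Cv vi)).
  have wF j : j != i -> F j (w 0 j) = a * F j (v 0 j).
    rewrite eq_sym => /unlift_some[m jE um]; move/rowP: wE => wE.
    by have := wE ((s^-1)%g m); rewrite !mxE permKV -jE /F um => ->.
  have /and3P[iU kU _] := U; move: iU kU; rewrite !inE negb_or => /andP[ik il] kl.
  have -> : u = w.
    apply: (eq_codeword U) => //; first by rewrite ui wi.
      by apply: (Finj k); rewrite E ?wF ?inE ?eqxx // eq_sym.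
    by apply: (Finj l); rewrite E ?wF ?inE ?eqxx ?orbT // eq_sym.
  exact: wF.
have [Ek [Ekb FkK EkK]] := lin_bij_inv (Fb k); have [El [Elb FlK ElK]] := lin_bij_inv (Fb l).
have [v2 Cv2 [v2i v2k v2l]] := codeword_exists 0 (Ek 1) 0 U.
have [v3 Cv3 [v3i v3k v3l]] := codeword_exists 0 0 (El 1) U.
have out j : j \notin [:: i; k; l] -> [/\ j != i, uniq [:: i; k; j] & uniq [:: i; l; j]].
  move: U; rewrite /= !inE !negb_or !andbT => /andP[/andP[ik il] kl] /and3P[ji jk jl].
  by rewrite ji ik il ![_ == j]eq_sym ji jk jl.
have nz E v m m' j : cancel E (F m) -> v \in C -> v 0 i = 0 -> v 0 m = E 1 -> v 0 m' = 0 ->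
    uniq [:: i; m'; j] -> F j (v 0 j) != 0.
  move=> EK Cv vi vm vm' U'; apply/eqP; rewrite -(F0 j) => /Finj vj.
  have v0 : v = 0 by apply: (eq_codeword U'); rewrite ?C0 ?mxE.
  by move: vm; rewrite v0 mxE => /(congr1 (F m)); rewrite EK F0 => /eqP; rewrite eq_sym oner_eq0.
pose b j := F j (v2 0 j) / F j (v3 0 j).
have p0 j : j \notin [:: i; k; l] -> F j (v2 0 j) != 0.
  by move=> /out[_ _ U']; apply: nz EkK Cv2 v2i v2k v2l U'.
have r0 j : j \notin [:: i; k; l] -> F j (v3 0 j) != 0.
  by move=> /out[_ U' _]; apply: nz ElK Cv3 v3i v3l v3k U'.
have main j y u v : j \notin [:: i; k; l] -> u \in C -> v \in C ->
      u 0 i = 0 -> u 0 l = 0 -> u 0 k = Ek y ->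
      v 0 i = 0 -> v 0 k = 0 -> v 0 l = El (b j * y) -> u 0 j = v 0 j.
  move=> jU Cu Cv ui ul uk vi vk vl; have [ji _ _] := out j jU.
  apply: (Finj j); rewrite (scale y u v2) // => [|m]; last first.
    by rewrite !inE => /orP[] /eqP->; rewrite ?uk ?v2k ?EkK ?EkK ?mulr1 // ul v2l F0 mulr0.
  rewrite (scale (b j * y) v v3) // => [|m]; last first.
    by rewrite !inE => /orP[] /eqP->; rewrite ?vl ?v3l ?ElK ?ElK ?mulr1 // vk v3k F0 mulr0.
  by rewrite mulrAC /b divfK ?r0 // mulrC.
exists Ek, El, b; split=> // [j jU|j j' jU j'U bE].
  by rewrite mulf_neq0 ?invr_eq0 ?p0 ?r0.
(* If [b j = b j'] with [j != j'], a word vanishing at [l] and one vanishing at [k] agree at [i],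
   [j], [j'], hence coincide. *)
apply/eqP/negPn/negP => jj'.
have [u Cu [ui uk ul]] := codeword_exists 0 (Ek 1) 0 U.
have [v Cv [vi vk vl]] := codeword_exists 0 0 (El (b j * 1)) U.
have U' : uniq [:: i; j; j'].
  have [ji _ _] := out j jU; have [j'i _ _] := out j' j'U.
  by rewrite /= !inE negb_or ![i == _]eq_sym ji j'i jj'.
have uv : u = v.
  apply: (eq_codeword U') => //; first by rewrite ui vi.
    exact: (main j 1).
  by apply: (main j' 1); rewrite // -bE.
by have := p0 j jU; have := EkK 1; rewrite -uk uv vk F0 => /eqP; rewrite eq_sym oner_eq0.
Qed.

(** * Coordinates with respect to three positions *)

Section Coordinates.
Variables i1 i2 i3 : 'I_n.
Hypothesis U : uniq [:: i1; i2; i3].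

(** The transformed code is parametrized [L]-linearly by its entries at the three positions, and
    [codeword_exists] makes these entries arbitrary. *)
Lemma linear_of_coordinates (f : 'I_n -> L -> L) (p r t : 'I_n -> L) :
  (forall j, Fq_linear_bij Fq (f j)) ->
  (forall v j, v \in C -> f j (v 0 j) =
    p j * f i1 (v 0 i1) + r j * f i2 (v 0 i2) + t j * f i3 (v 0 i3)) ->
  Fq_equiv_to_linear Fq C.
Proof.
move=> fb fE; exists [set \row_j f j (v 0 j) | v : 'rV[L]_n in C]; split; last first.
  exists 1%g, f; split=> //; apply: eq_imset => v.
  by apply/rowP => j; rewrite !mxE perm1.
split=> [|_ _ /imsetP[u Cu ->] /imsetP[v Cv ->]|c _ /imsetP[v Cv ->]].
- apply/imsetP; exists 0; rewrite ?C0 //; apply/rowP => j; rewrite !mxE.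
  by rewrite (Fq_lin0 (lin_bij_lin (fb j))).
- apply/imsetP; exists (u + v); rewrite ?CD //; apply/rowP => j; rewrite !mxE.
  by case: (fb j) => ->.
have [g1 [_ _ g1K]] := lin_bij_inv (fb i1); have [g2 [_ _ g2K]] := lin_bij_inv (fb i2).
have [g3 [_ _ g3K]] := lin_bij_inv (fb i3).
have [w Cw [w1 w2 w3]] := codeword_exists (g1 (c * f i1 (v 0 i1)))
  (g2 (c * f i2 (v 0 i2))) (g3 (c * f i3 (v 0 i3))) U.
apply/imsetP; exists w => //; apply/rowP => j; rewrite !mxE.
by rewrite (fE v j) // (fE w j) // w1 w2 w3 g1K g2K g3K; ring.
Qed.

(** The default [0] is never reached, by [codeword_exists]. *)
Definition cw (x y z : L) : 'rV[L]_n := odflt 0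
  [pick v in C | [&& v 0 i1 == x, v 0 i2 == y & v 0 i3 == z]].

Lemma cwP x y z : [/\ cw x y z \in C, cw x y z 0 i1 = x, cw x y z 0 i2 = y &
  cw x y z 0 i3 = z].
Proof.
rewrite /cw; case: pickP => [v /and4P[Cv /eqP ? /eqP ? /eqP ?] //|E].
have [v Cv [v1 v2 v3]] := codeword_exists x y z U.
by have := E v; rewrite Cv v1 v2 v3 !eqxx.
Qed.

Lemma cwE v : v \in C -> v = cw (v 0 i1) (v 0 i2) (v 0 i3).
Proof.
move=> Cv; have [Cw w1 w2 w3] := cwP (v 0 i1) (v 0 i2) (v 0 i3).
exact: (eq_codeword U).
Qed.

Lemma cwD x y z x' y' z' : cw (x + x') (y + y') (z + z') = cw x y z + cw x' y' z'.
Proof.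
have [Cv v1 v2 v3] := cwP x y z; have [Cw w1 w2 w3] := cwP x' y' z'.
by rewrite [RHS]cwE ?CD // !mxE v1 v2 v3 w1 w2 w3.
Qed.

Lemma cwZ c x y z : c \in Fq -> cw (c * x) (c * y) (c * z) = c *: cw x y z.
Proof.
move=> Fc; have [Cv v1 v2 v3] := cwP x y z.
by rewrite [RHS]cwE ?CZ // !mxE v1 v2 v3.
Qed.

Lemma cw_split x y z : cw x y z = cw x 0 0 + cw 0 y 0 + cw 0 0 z.
Proof. by rewrite -!cwD !addr0 !add0r. Qed.

(** On a finite field injectivity suffices: two such words with equal entries at [j] agree at [i1],
    [i2] and [j]. *)
Lemma cw3_bij j : j \notin [:: i1; i2; i3] -> Fq_linear_bij Fq (fun z => cw 0 0 z 0 j).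
Proof.
move=> jU.
have D x y : cw 0 0 (x + y) 0 j = cw 0 0 x 0 j + cw 0 0 y 0 j.
  by rewrite -{1 2}(addr0 0) cwD mxE.
split=> //.
  by move=> c x Fc; rewrite -{1 2}(mulr0 c) cwZ // mxE.
apply: injF_bij => x y E.
have [Cv v1 v2 v3] := cwP 0 0 x; have [Cw w1 w2 w3] := cwP 0 0 y.
suff e : cw 0 0 x = cw 0 0 y by rewrite -v3 e w3.
apply: (@eq_codeword i1 i2 j); rewrite ?v1 ?v2 ?w1 ?w2 //.
move: U jU; rewrite /= !inE !negb_or !andbT => /andP[/andP[-> _] _] /and3P[ji jk _].
by rewrite ![_ == j]eq_sym ji jk.
Qed.

(** Undoing [E1], [E2], [E3] at the three positions, and the map sending [z] to [cw 0 0 (E3 z) 0 j]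
    at the others, gives a generator matrix with unit columns and columns [(p j, r j, 1)]. *)
Lemma linear_of_ratios (E1 E2 E3 : L -> L) (p r : 'I_n -> L) :
  Fq_linear_bij Fq E1 -> Fq_linear_bij Fq E2 -> Fq_linear_bij Fq E3 ->
  (forall j x, j \notin [:: i1; i2; i3] -> cw (E1 x) 0 0 0 j = cw 0 0 (E3 (p j * x)) 0 j) ->
  (forall j y, j \notin [:: i1; i2; i3] -> cw 0 (E2 y) 0 0 j = cw 0 0 (E3 (r j * y)) 0 j) ->
  Fq_equiv_to_linear Fq C.
Proof.
move=> b1 b2 b3 HX HY.
have [F1 [F1b E1K F1K]] := lin_bij_inv b1; have [F2 [F2b E2K F2K]] := lin_bij_inv b2.
have [F3 [F3b E3K F3K]] := lin_bij_inv b3.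
have [f1 f2 f3] : [/\ i2 != i1, i3 != i1 & i3 != i2].
  move: U; rewrite /= !inE !negb_or !andbT => /andP[/andP[h1 h2] h3].
  by split; rewrite eq_sym.
pose p' j := if j == i1 then 1 else if j \in [:: i2; i3] then 0 else p j.
pose r' j := if j == i2 then 1 else if j \in [:: i1; i3] then 0 else r j.
pose t' j : L := if j \in [:: i1; i2] then 0 else 1.
pose P j (f : L -> L) := [/\ Fq_linear_bij Fq f,
    j = i1 -> f =1 F1, j = i2 -> f =1 F2, j = i3 -> f =1 F3 &
    forall v, v \in C -> f (v 0 j) =
      p' j * F1 (v 0 i1) + r' j * F2 (v 0 i2) + t' j * F3 (v 0 i3)].
have [f fP] : exists f : 'I_n -> L -> L, forall j, P j (f j).
  apply: (@fin_all_exists _ (fun=> L -> L) P) => j.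
  have [j1|j1] := eqVneq j i1.
    exists F1; split=> // [e|e|v _]; try by rewrite -e j1 eqxx in f1 f2 f3.
    rewrite j1 /p' /r' /t' !inE eqxx eq_sym (negPf f1) /=.
    by rewrite mul1r !mul0r !addr0.
  have [j2|j2] := eqVneq j i2.
    exists F2; split=> // [e|e|v _]; try by rewrite -e j2 eqxx in f1 f2 f3 j1.
    by rewrite j2 /p' /r' /t' !inE eqxx orbT (negPf f1) mul1r !mul0r addr0 add0r.
  have [j3|j3] := eqVneq j i3.
    exists F3; split=> // [e|e|v _]; try by rewrite -e ?j3 eqxx in j1 j2.
    rewrite j3 /p' /r' /t' !inE eqxx !orbT (negPf f2) (negPf f3) /=.
    by rewrite mul1r !mul0r !add0r.
  have jU : j \notin [:: i1; i2; i3] by rewrite !inE !negb_or j1 j2 j3.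
  have [F [Fb ZK FK]] := lin_bij_inv (lin_bij_comp (cw3_bij jU) b3).
  exists F; split=> // [e|e|e|v Cv]; try by rewrite e eqxx in j1 j2 j3.
  apply: (can_inj ZK); rewrite FK /= /p' /r' /t' !inE (negPf j1) (negPf j2) (negPf j3) /= mul1r.
  case: (b3) => E3D _ _; have Z3D x y : cw 0 0 (x + y) 0 j = cw 0 0 x 0 j + cw 0 0 y 0 j.
    by rewrite -{1 2}(addr0 0) cwD mxE.
  by rewrite !E3D !Z3D -HX // -HY // F1K F2K F3K {1}(cwE Cv) cw_split !mxE.
apply: (@linear_of_coordinates f p' r' t') => [j|v j Cv]; first by case: (fP j).
have [_ -> // _ _ _] := fP i1; have [_ _ -> // _ _] := fP i2.
by have [_ _ _ -> // _] := fP i3; have [_ _ _ _ ->] := fP j.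
Qed.

End Coordinates.
End MDSCode.

(** * Combining the three linear projections *)

Theorem theorem1p1 (L : finFieldType) (Fq : {set L}) (q h n : nat)
  (Hq : exists p k : nat, prime p /\ q = (p ^ k)%N)
  (HFq : is_subfield Fq) (HcardFq : #|Fq| = q)
  (Hh : (1 <= h)%N) (HcardL : #|L| = (q ^ h)%N)
  (C : {set 'rV[L]_n})
  (HlinC : Fq_linear Fq C)
  (Hpar : code_params C (q ^ (3 * h)) (n - 2))
  (HMDS : MDS C)
  (Hcase : (h = 2%N /\ (2 * q + 3 <= n)%N) \/
           (h = 3%N /\ (q ^ 2 + 3 + (q == 2%N) <= n)%N))
  (Hproj : exists S : {set 'I_n}, (3 <= #|S|)%N /\
           forall i, i \in S -> Fq_equiv_to_linear Fq (proj C i)) :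
  Fq_equiv_to_linear Fq C.
Proof.
case: Hpar => cC dC; subst q.
have {}cC : #|C| = (#|L| ^ 3)%N by rewrite cC HcardL -expnM mulnC.
case: Hproj => S [/card_gt2P[i1 [i2 [i3 [[S1 S2 S3] [n12 n23 n31]]]]] PS].
have U : uniq [:: i1; i2; i3] by rewrite /= !inE negb_or n12 n23 eq_sym n31.
have U2 : uniq [:: i2; i1; i3] by rewrite /= !inE negb_or n23 eq_sym n12 eq_sym n31.
have U3 : uniq [:: i3; i2; i1] by rewrite /= !inE negb_or n31 eq_sym n23 eq_sym n12.
have out j : j \notin [:: i1; i2; i3] ->
    j \notin [:: i2; i1; i3] /\ j \notin [:: i3; i2; i1].
  by rewrite !inE !negb_or => /and3P[-> -> ->].
(* At each further position [j] the projections compare the contribution of [i2] with that of [i3],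
   [i1] with [i3], and [i2] with [i1]. *)
have [al2 [al3 [b [al2b al3b b0 bi bE]]]] := proj_linear HlinC cC dC U (PS _ S1).
have [be1 [be3 [a [be1b be3b a0 ai aE]]]] := proj_linear HlinC cC dC U2 (PS _ S2).
have [ga2 [ga1 [c [ga2b ga1b c0 _ cE]]]] := proj_linear HlinC cC dC U3 (PS _ S3).
pose w := cw C i1 i2 i3.
have YZ j y : j \notin [:: i1; i2; i3] -> w 0 (al2 y) 0 0 j = w 0 0 (al3 (b j * y)) 0 j.
  move=> jU; have [Cu u1 u2 u3] := cwP cC dC U 0 (al2 y) 0.
  have [Cv v1 v2 v3] := cwP cC dC U 0 0 (al3 (b j * y)).
  exact: (bE j y).
have XZ j x : j \notin [:: i1; i2; i3] -> w (be1 x) 0 0 0 j = w 0 0 (be3 (a j * x)) 0 j.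
  move=> /out[jU _]; have [Cu u1 u2 u3] := cwP cC dC U (be1 x) 0 0.
  have [Cv v1 v2 v3] := cwP cC dC U 0 0 (be3 (a j * x)).
  exact: (aE j x).
have YX j y : j \notin [:: i1; i2; i3] -> w 0 (ga2 y) 0 0 j = w (ga1 (c j * y)) 0 0 0 j.
  move=> /out[_ jU]; have [Cu u1 u2 u3] := cwP cC dC U 0 (ga2 y) 0.
  have [Cv v1 v2 v3] := cwP cC dC U (ga1 (c j * y)) 0 0.
  exact: (cE j y).
have [be1' [be1'b be1K be1'K]] := lin_bij_inv be1b.
have [be3' [be3'b be3K be3'K]] := lin_bij_inv be3b.
have [al2' [al2'b al2K al2'K]] := lin_bij_inv al2b.
(* Each chosen position has two normalizations, one from each of the other two projections; [G],
   [H], [K] are the changes between them at [i1], [i3], [i2]. *)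
pose G := be1' \o ga1; pose H := be3' \o al3; pose K := al2' \o ga2.
have Gb : Fq_linear_bij Fq G by apply: lin_bij_comp.
have Hb : Fq_linear_bij Fq H by apply: lin_bij_comp.
have Kb : Fq_linear_bij Fq K by apply: lin_bij_comp.
have [G' [G'b GK G'K]] := lin_bij_inv Gb; have [H' [H'b HK H'K]] := lin_bij_inv Hb.
have [K' [K'b KK K'K]] := lin_bij_inv Kb.
have GE x : be1 (G x) = ga1 x by rewrite /G /= be1'K.
have HE x : be3 (H x) = al3 x by rewrite /H /= be3'K.
have KE x : al2 (K x) = ga2 x by rewrite /K /= al2'K.
(* At [j] there are two routes from [i2] to [i3], through [i1] or directly; injectivity of the
   contribution of [i3] equates them. *)
have GHK j x : j \notin [:: i1; i2; i3] -> a j * G (c j * x) = H (b j * K x).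
  move=> jU; have [_ _ Zb] := lin_bij_comp (cw3_bij HlinC cC dC U jU) be3b.
  apply: (bij_inj Zb); rewrite /= -/w -XZ // GE HE -YZ // KE YX //.
pose J : finType := {j : 'I_n | j \notin [:: i1; i2; i3]}.
have cJ : #|J| = (n - 3)%N.
  have := cardC (mem [:: i1; i2; i3]); rewrite card_ord (card_uniqP U) /= => cU.
  by rewrite card_sig -[X in (X - 3)%N]cU addKn.
have h23 : h = 2%N \/ h = 3%N by case: Hcase => -[]; auto.
have q1 := Fq_gt1 HFq.
(* For the [n - 3] remaining positions the strict bound follows from [2 * q > 2 * (q - 1)] if
   [h = 2] and from [q ^ 2 > 3 * (q - 1)] if [h = 3]. *)
have [J1 J2] : (#|Fq| ^ h.-1 <= #|J|)%N /\ (h * #|Fq|.-1 < #|J|)%N.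
  rewrite cJ; move: q1 Hcase; move: #|Fq| => q q1.
  by case=> -[-> /=]; rewrite ?expn1 -?mulnn => n3; split; nia.
have E (j : J) x : a (val j) * G (c (val j) * x) = H (b (val j) * K x).
  exact: GHK (valP j).
have a0' (j : J) : a (val j) != 0 by apply: a0; have [] := out _ (valP j).
have b0' (j : J) : b (val j) != 0 by apply: b0 (valP j).
have c0' (j : J) : c (val j) != 0 by apply: c0; have [] := out _ (valP j).
have ai' : injective (fun j : J => a (val j)).
  move=> j k; have [jU _] := out _ (valP j); have [kU _] := out _ (valP k).
  by move/(ai _ _ jU kU)/val_inj.
have bi' : injective (fun j : J => b (val j)).
  by move=> j k /(bi _ _ (valP j) (valP k))/val_inj.
have [[tau T]|[tau T]|[tau T]] := semilinear_relation HFq Hq Hh HcardL h23 a0' b0' c0'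
  ai' bi' (lin_bij_lin Gb) (lin_bij_lin Hb) (lin_bij_lin Kb) KK K'K E J1 J2.
(* Each case renormalizes one position by the inverse of the semilinear map, [i2] by [G'] or [H']
   and [i1] by [K'], so that the scalar passes through as a value of [tau]. *)
- apply: (linear_of_ratios HlinC cC dC U (p := a) (r := fun j => a j * tau (c j))
    be1b (lin_bij_comp ga2b G'b) be3b) => j x jU; first exact: XZ.
  by rewrite -/w /= YX // -GE T G'K XZ // mulrA.
- apply: (linear_of_ratios HlinC cC dC U (p := a) (r := fun j => tau (b j))
    be1b (lin_bij_comp al2b H'b) be3b) => j x jU; first exact: XZ.
  by rewrite -/w /= YZ // -HE T H'K.
- apply: (linear_of_ratios HlinC cC dC U (p := fun j => b j * tau (c j)^-1) (r := b)
    (lin_bij_comp ga1b K'b) al2b al3b) => j x jU; last exact: YZ.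
  have cj : c j != 0 by apply: c0; have [] := out _ jU.
  by rewrite -/w /= -{1}(mulVKf cj (K' x)) -YX // -KE T K'K YZ // mulrA.
Qed.
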